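(* Let $n\ge 1$ and let $(r_i,s_i,t_i)$, $i=1,\ldots,n$, be triplets of positive integers. Let $L$ be a Latin square of order $n$ on the symbols $\{1,\ldots,n\}$, and write $L(i,j)$ for its entry in row $i$ and column $j$. If for all $1\le i,j\le n$, with $k=L(i,j)$, the complete tripartite graph $K_{r_i,s_j,t_k}$ can be decomposed into $5$-cycles, then the complete tripartite graph $$K_{r_1+\cdots+r_n,\ s_1+\cdots+s_n,\ t_1+\cdots+t_n}$$ has a decomposition into $5$-cycles.
   Context: $K_{r,s,t}$ denotes the complete tripartite graph with parts of sizes $r,s,t$ (no ordering of $r,s,t$ is assumed). A decomposition of a graph into $5$-cycles is a partition of its edge set into edge sets of cycles of length $5$. A Latin square of order $n$ is an $n\times n$ array in which every symbol of $\{1,\ldots,n\}$ occurs exactly once in each row and each column. *)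

(* Defs.v *)
From mathcomp Require Import all_boot all_order all_algebra.

Set Implicit Arguments.
Unset Strict Implicit.
Unset Printing Implicit Defensive.

Section CycleDecomposition.

(* A simple graph on T is given by a symmetric irreflexive adjacency relation;
   an edge is the two-element set of its endpoints. *)
Variables (T : finType) (e : rel T).

Definition edge_set : {set {set T}} :=
  [set [set p.1; p.2] | p : T * T & e p.1 p.2].

(* The cycle visits the vertices of c in order, and [next] wraps around. *)
Definition is_5cycle_edge_set (C : {set {set T}}) : Prop :=
  exists c : seq T,
    [/\ size c = 5, ucycle e c & C = [set [set x; next c x] | x in c]].

Definition decomposable_into_5cycles : Prop :=
  exists P : {set {set {set T}}},
    partition P edge_set /\ (forall C, C \in P -> is_5cycle_edge_set C).

End CycleDecomposition.

Definition tripartite_vertex (r s t : nat) : finType :=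
  ('I_r + 'I_s + 'I_t)%type.

Definition part r s t (v : tripartite_vertex r s t) : 'I_3 :=
  match v with
  | inl (inl _) => inord 0
  | inl (inr _) => inord 1
  | inr _ => inord 2
  end.

Definition complete_tripartite (r s t : nat) : rel (tripartite_vertex r s t) :=
  fun u v => part u != part v.
Arguments complete_tripartite : clear implicits.

Definition latin_square (n : nat) (L : 'M['I_n]_n) : Prop :=
  (forall i k, exists! j, L i j = k) /\ (forall j k, exists! i, L i j = k).

(* Main.v *)
Require Import Defs.
From mathcomp Require Import all_boot all_order all_algebra.

(** Cut each part of the large graph into [n] consecutive blocks, of sizes
    [r i], [s j] and [t k].  For every cell [(i, j)] of the Latin square, the
    subgraph induced on row block [i], column block [j] and symbol block
    [L i j] is a copy of a graph that decomposes by hypothesis.  The triples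
    [(i, j, L i j)] form an orthogonal array: any two coordinates, with
    prescribed values, determine the cell ([latin_square_cell_unique]).  An edge
    of the large graph has its ends in two different parts, hence prescribes
    exactly two coordinates, so it lies in exactly one of these induced
    subgraphs.  The theorem is then an instance of a general gluing principle
    ([decomposable_glue]): if induced subgraphs share out the edges of a graph,
    decompositions of the pieces unite into a decomposition of the whole. *)

(** * Gluing decompositions of induced subgraphs *)

Lemma is_5cycle_edge_set_imset {U T : finType} {d : rel U} {e : rel T}
    {f : U -> T} :
    injective f -> {mono f : x y / d x y >-> e x y} ->
  forall C, is_5cycle_edge_set d C ->
  is_5cycle_edge_set e [set f @: E | E : {set U} in C].
Proof.
move=> f_inj f_mono C [c [c5 /andP[c_cyc c_uniq] ->]].
exists (map f c); split; first by rewrite size_map.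
  by rewrite /ucycle (mono_cycle f_mono) (map_inj_uniq f_inj) c_cyc.
rewrite -imset_comp; apply/setP=> E; apply/imsetP/imsetP => [[x xc ->]|[y]].
  by exists (f x); rewrite ?map_f //= imsetU1 imset_set1 next_map.
by case/mapP=> x xc -> ->; exists x; rewrite //= imsetU1 imset_set1 next_map.
Qed.

(** The piece is an induced subgraph, so an edge with both ends in the image
    comes from the piece. *)
Lemma edge_set_imset {U T : finType} {d : rel U} {e : rel T} {f : U -> T} :
    {mono f : x y / d x y >-> e x y} ->
  [set f @: E | E : {set U} in edge_set d]
    = [set E in edge_set e | E \subset [set v in codom f]].
Proof.
move=> f_mono; apply/setP=> E; rewrite inE; apply/imsetP/andP.
  case=> _ /imsetP[[x y] dxy ->] ->; rewrite inE /= in dxy.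
  rewrite imsetU1 imset_set1; split; last by rewrite subUset !sub1set !inE !codom_f.
  by apply/imsetP; exists (f x, f y); rewrite // inE /= f_mono.
case=> /imsetP[[a b] eab ->]; rewrite inE /= in eab.
rewrite subUset !sub1set !inE => /andP[/codomP[x ax] /codomP[y by_]].
exists [set x; y]; last by rewrite imsetU1 imset_set1 ax by_.
by apply/imsetP; exists (x, y); rewrite // inE /= -f_mono -ax -by_.
Qed.

Lemma partition_bigcup {X I : finType} (P : I -> {set {set X}})
    (D : I -> {set X}) :
    (forall i, partition (P i) (D i)) ->
    (forall i j x, x \in D i -> x \in D j -> i = j) ->
  partition (\bigcup_i P i) (\bigcup_i D i).
Proof.
move=> partP disjD; apply/and3P; split.
- apply/eqP/setP=> x; apply/bigcupP/bigcupP => [[B /bigcupP[i _ BPi] xB]|].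
    by exists i => //; rewrite -(cover_partition (partP i)); apply/bigcupP; exists B.
  case=> i _; rewrite -(cover_partition (partP i)) => /bigcupP[B BPi xB].
  by exists B => //; apply/bigcupP; exists i.
- apply/trivIsetP=> A B /bigcupP[i _ APi] /bigcupP[j _ BPj] neqAB.
  have [ij|neq_ij] := eqVneq i j.
    rewrite -ij in BPj.
    by apply: (trivIsetP (partition_trivIset (partP i))).
  rewrite disjoint_subset; apply/subsetP=> x xA; rewrite inE.
  apply: contraNN neq_ij => xB; apply/eqP/(disjD _ _ x).
    exact: (subsetP (partitionS (partP i) APi)).
  exact: (subsetP (partitionS (partP j) BPj)).
- by apply/bigcupP=> -[i _]; apply/negP; case/and3P: (partP i).
Qed.

(** An edge shared by two pieces [i] and [j] is contained in both images, and
    therefore has both its ends in each of them; this is why it suffices to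
    locate the ends of each edge, without naming their preimages. *)
Lemma decomposable_glue {T I : finType} {e : rel T} {U : I -> finType}
    {d : forall i, rel (U i)} {f : forall i, U i -> T} :
    (forall i, injective (f i)) ->
    (forall i, {mono f i : x y / d i x y >-> e x y}) ->
    (forall a b, e a b -> exists! i, a \in codom (f i) /\ b \in codom (f i)) ->
    (forall i, decomposable_into_5cycles (d i)) ->
  decomposable_into_5cycles e.
Proof.
move=> f_inj f_mono e_glue /fin_all_exists[P decP].
pose lift i (C : {set {set U i}}) := [set f i @: E | E : {set U i} in C].
exists (\bigcup_i [set lift i C | C in P i]); split; last first.
  move=> _ /bigcupP[i _ /imsetP[C CPi ->]].
  apply: (is_5cycle_edge_set_imset (f_inj i) (f_mono i)).
  by have [_] := decP i; apply.
have -> : edge_set e =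
    \bigcup_i [set E in edge_set e | E \subset [set v in codom (f i)]].
  apply/setP=> E; apply/idP/bigcupP=> [Ee|[i _]]; last by rewrite inE => /andP[].
  have /imsetP[[a b]] := Ee; rewrite inE /= => /e_glue[i [[ai bi] _]] defE.
  by exists i; rewrite // inE Ee defE subUset !sub1set !inE ai.
apply: partition_bigcup => [i|i j E].
  rewrite -(edge_set_imset (f_mono i)) (imset_partition _ _ (imset_inj (f_inj i))).
  by have [] := decP i.
rewrite !inE => /andP[/imsetP[[a b]]]; rewrite inE /= => /e_glue[k [_ k_uniq]] ->.
rewrite !subUset !sub1set !inE => /andP[ai bi] /and3P[_ aj bj].
by rewrite -(k_uniq i) // (k_uniq j).
Qed.

(** * The blocks of a complete tripartite graph *)

Definition block_embedding {n} (r s t : 'I_n -> nat) (i j k : 'I_n)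
    (v : tripartite_vertex (r i) (s j) (t k)) :
    tripartite_vertex (\sum_(i < n) r i) (\sum_(i < n) s i) (\sum_(i < n) t i) :=
  match v with
  | inl (inl x) => inl (inl (tagnat.Rank i x))
  | inl (inr y) => inl (inr (tagnat.Rank j y))
  | inr z => inr (tagnat.Rank k z)
  end.

(** A vertex constrains only one of the three coordinates, the one that its part
    selects; this is what makes an edge constrain exactly two. *)
Definition in_blocks {n} {r s t : 'I_n -> nat} (i j k : 'I_n)
    (v : tripartite_vertex (\sum_(i < n) r i) (\sum_(i < n) s i)
                           (\sum_(i < n) t i)) : bool :=
  match v with
  | inl (inl x) => tagnat.sig1 x == i
  | inl (inr y) => tagnat.sig1 y == j
  | inr z => tagnat.sig1 z == k
  end.

Lemma tagnat_Rank_inj {n} (p : 'I_n -> nat) i : injective (@tagnat.Rank n p i).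
Proof.
move=> x y /(congr1 (fun u => val (tagnat.sig2 u))).
by rewrite !tagnat.Rank2K /= => /ord_inj.
Qed.

Lemma block_embedding_inj {n} (r s t : 'I_n -> nat) i j k :
  injective (block_embedding r s t i j k).
Proof.
move=> [[x|x]|x] [[y|y]|y] //=.
- by move=> E; rewrite (tagnat_Rank_inj r i _ _ (inl_inj (inl_inj E))).
- by move=> E; rewrite (tagnat_Rank_inj s j _ _ (inr_inj (inl_inj E))).
- by move=> E; rewrite (tagnat_Rank_inj t k _ _ (inr_inj E)).
Qed.

Lemma part_block_embedding {n} (r s t : 'I_n -> nat) i j k v :
  part (block_embedding r s t i j k v) = part v.
Proof. by case: v => [[]|]. Qed.

Lemma codom_block_embedding {n} (r s t : 'I_n -> nat) i j k v :
  (v \in codom (block_embedding r s t i j k)) = in_blocks i j k v.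
Proof.
apply/codomP/idP=> [[[[x|x]|x] ->] /=|]; rewrite ?tagnat.Rank1K //.
case: v => [[x|x]|x] /= /eqP <-.
- by exists (inl (inl (tagnat.sig2 x))); rewrite /= tagnat.sig2K.
- by exists (inl (inr (tagnat.sig2 x))); rewrite /= tagnat.sig2K.
- by exists (inr (tagnat.sig2 x)); rewrite /= tagnat.sig2K.
Qed.

(** The orthogonal array property of Latin squares: two vertices in different
    parts prescribe two of row, column and symbol.  Row and column name the
    cell, while the Latin conditions recover the column from row and symbol,
    and the row from column and symbol. *)
Lemma latin_square_cell_unique {n} {r s t : 'I_n -> nat} {L : 'M['I_n]_n}
    {a b : tripartite_vertex (\sum_(i < n) r i) (\sum_(i < n) s i)
                             (\sum_(i < n) t i)} :
    latin_square L -> part a != part b ->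
  exists! c : 'I_n * 'I_n,
    in_blocks c.1 c.2 (L c.1 c.2) a /\ in_blocks c.1 c.2 (L c.1 c.2) b.
Proof.
move=> [row_L col_L].
(* By symmetry, only the three ordered pairs of distinct parts remain. *)
wlog: a b / (part a <= part b)%N.
  move=> wl neq_ab; case: (leqP (part a) (part b)) => [|/ltnW] le_ab.
    exact: wl.
  have [|c [[cb ca] c_uniq]] := wl b a le_ab; first by rewrite eq_sym.
  by exists c; split=> // c' [c'a c'b]; apply: c_uniq.
case: a b => [[x|x]|x] [[y|y]|y]; rewrite /= ?eqxx ?inordK // => _ _.
- exists (tagnat.sig1 x, tagnat.sig1 y); split=> [|[i j]] /=; first by rewrite !eqxx.
  by case=> /eqP -> /eqP ->.
- have [j [Lj j_uniq]] := row_L (tagnat.sig1 x) (tagnat.sig1 y).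
  exists (tagnat.sig1 x, j); split=> [|[i' j']] /=; first by rewrite Lj !eqxx.
  by case=> /eqP <- /eqP/esym/j_uniq ->.
- have [i [Li i_uniq]] := col_L (tagnat.sig1 x) (tagnat.sig1 y).
  exists (i, tagnat.sig1 x); split=> [|[i' j']] /=; first by rewrite Li !eqxx.
  by case=> /eqP <- /eqP/esym/i_uniq ->.
Qed.

Theorem theorem2p4 (n : nat) (hn : 0 < n) (r s t : 'I_n -> nat)
  (hpos : forall i, [/\ 0 < r i, 0 < s i & 0 < t i])
  (L : 'M['I_n]_n) (hL : latin_square L)
  (hdec : forall i j : 'I_n,
     decomposable_into_5cycles (complete_tripartite (r i) (s j) (t (L i j)))) :
  decomposable_into_5cycles
    (complete_tripartite (\sum_(i < n) r i) (\sum_(i < n) s i)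
                         (\sum_(i < n) t i)).
Proof.
pose U (c : 'I_n * 'I_n) := tripartite_vertex (r c.1) (s c.2) (t (L c.1 c.2)).
pose f c := block_embedding r s t c.1 c.2 (L c.1 c.2).
have codom_f c v : (v \in codom (f c)) = in_blocks c.1 c.2 (L c.1 c.2) v.
  exact: codom_block_embedding.
apply: (decomposable_glue (U := U) (d := fun=> complete_tripartite _ _ _) (f := f)).
- by move=> c; apply: block_embedding_inj.
- by move=> c u v; rewrite /complete_tripartite !part_block_embedding.
- move=> a b /(latin_square_cell_unique hL)[c [[ca cb] c_uniq]].
  exists c; split=> [|c' [c'a c'b]]; first by split; rewrite codom_f.
  by apply: c_uniq; rewrite -!codom_f.
- by move=> c; apply: hdec.
Qed.
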